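(* Refinement modal logic $\mathsf{RML}$ is doubly exponentially more succinct than modal logic $\mathsf K$, and refinement $\mu$-calculus $\mathsf{RML}^\mu$ is doubly exponentially more succinct than the modal $\mu$-calculus.
   Context: Models $M=(S,R,V)$ with states $S$, relations $R_a\subseteq S\times S$ for agents $a$, valuation $V$ on propositional variables. $M_s\succeq_a M'_{s'}$ means there is a nonempty relation $\mathfrak F$ containing $(s,s')$ such that related states agree on all propositional variables, every $R'_b$-successor of a related state $s'$ ($b$ any agent) is $\mathfrak F$-related to some $R_b$-successor of $s$, and for agents $b\neq a$ every $R_b$-successor of $s$ is $\mathfrak F$-related to some $R'_b$-successor of $s'$. $\mathsf K$ is the modal logic with language $\mathcal L$: $\varphi::=p\mid\neg\varphi\mid\varphi\wedge\varphi\mid\Box_a\varphi$; $\mathsf{RML}$ adds $\forall_a\varphi$, true at $M_s$ iff $\varphi$ holds at every $M'_{s'}$ with $M_s\succeq_a M'_{s'}$. The modal $\mu$-calculus adds least fixed points $\mu x.\varphi$ ($x$ positive in $\varphi$) to $\mathcal L$, and $\mathsf{RML}^\mu$ adds both $\mu x.\varphi$ and $\forall_a\varphi$. A logic $L_1$ is doubly exponentially more succinct than a logic $L_2$ if there is a family $(\varphi_n)_{n\in\mathbb N}$ of $L_1$-formulas of size polynomial in $n$ such that every $L_2$-formula equivalent to $\varphi_n$ (true at exactly the same pointed models) has size at least $2^{2^{\Omega(n)}}$. *)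

(* Defs.v *)
From mathcomp Require Import all_boot.

Set Implicit Arguments.
Unset Strict Implicit.
Unset Printing Implicit Defensive.

(* [A] is the type of agents; propositional variables are natural numbers.    *)

Record model (A : Type) : Type := Model {
  state :> Type;
  acc : A -> state -> state -> Prop;
  valuation : nat -> state -> Prop
}.

(* [refines a s s'] is M_s ⪰_a M'_{s'}: only the forth condition for [a] is   *)
(* dropped.  Nonemptiness of [F] is implied by [F s s'].                      *)
Definition refines (A : Type) (a : A) (M M' : model A) (s : M) (s' : M') :
    Prop :=
  exists F : M -> M' -> Prop,
    [/\ F s s',
        forall t t', F t t' ->
          forall p, valuation p t <-> valuation p t',
        forall t t', F t t' -> forall (b : A) (u' : M'), acc b t' u' ->
          exists2 u : M, acc b t u & F u u'
      & forall t t', F t t' -> forall (b : A) (u : M), b <> a -> acc b t u ->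
          exists2 u' : M', acc b t' u' & F u u'].

(* Raw syntax of the largest language; the four logics are the fragments      *)
(* below.  Fixed-point variables are propositional variables: a free variable *)
(* is an ordinary atom, read off the valuation and preserved by refinement.   *)
Inductive form (A : Type) : Type :=
| Var of nat
| Neg of form A
| And of form A & form A
| Box of A & form A
| All of A & form A
| Mu of nat & form A.

Arguments Var {A} p.
Arguments Mu {A} x phi.

(* Number of symbols, each of □_a, ∀_a and μx counting as one.                *)
Fixpoint fsize (A : Type) (phi : form A) : nat :=
  match phi with
  | Var _ => 1
  | Neg phi => (fsize phi).+1
  | And phi psi => (fsize phi + fsize psi).+1
  | Box _ phi => (fsize phi).+1
  | All _ phi => (fsize phi).+1
  | Mu _ phi => (fsize phi).+1
  end.

Definition update (A : Type) (M : model A) (x : nat) (T : M -> Prop) :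
    model A :=
  Model (@acc A M) (fun p => if p == x then T else valuation p).

(* μx.φ denotes the intersection of all sets T of states with                 *)
(* ⟦φ⟧_{M[x ↦ T]} ⊆ T; it is the least fixed point when x is positive in φ.   *)
Fixpoint sat (A : Type) (M : model A) (phi : form A) (s : M) {struct phi} :
    Prop :=
  match phi with
  | Var p => valuation p s
  | Neg phi => ~ sat phi s
  | And phi psi => sat phi s /\ sat psi s
  | Box a phi => forall t : M, acc a s t -> sat phi t
  | All a phi => forall (M' : model A) (s' : M'), refines a s s' -> sat phi s'
  | Mu x phi => forall T : M -> Prop,
      (forall t : M, @sat A (update x T) phi t -> T t) -> T s
  end.

Definition equivalent (A : Type) (phi psi : form A) : Prop :=
  forall (M : model A) (s : M), sat phi s <-> sat psi s.

(* Every free occurrence of [x] is under an even ([b = true]) or odd          *)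
(* ([b = false]) number of negations.                                         *)
Fixpoint polarity (A : Type) (b : bool) (x : nat) (phi : form A) : bool :=
  match phi with
  | Var p => (p == x) ==> b
  | Neg phi => polarity (~~ b) x phi
  | And phi psi => polarity b x phi && polarity b x psi
  | Box _ phi => polarity b x phi
  | All _ phi => polarity b x phi
  | Mu y phi => (y == x) || polarity b x phi
  end.

Fixpoint well_formed (A : Type) (phi : form A) : bool :=
  match phi with
  | Var _ => true
  | Neg phi => well_formed phi
  | And phi psi => well_formed phi && well_formed psi
  | Box _ phi => well_formed phi
  | All _ phi => well_formed phi
  | Mu x phi => polarity true x phi && well_formed phi
  end.

Fixpoint mu_free (A : Type) (phi : form A) : bool :=
  match phi with
  | Var _ => true
  | Neg phi => mu_free phi
  | And phi psi => mu_free phi && mu_free psi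
  | Box _ phi => mu_free phi
  | All _ phi => mu_free phi
  | Mu _ _ => false
  end.

Fixpoint all_free (A : Type) (phi : form A) : bool :=
  match phi with
  | Var _ => true
  | Neg phi => all_free phi
  | And phi psi => all_free phi && all_free psi
  | Box _ phi => all_free phi
  | All _ _ => false
  | Mu _ phi => all_free phi
  end.

Definition logic_K (A : Type) : pred (form A) :=
  [pred phi | mu_free phi && all_free phi].
Definition logic_RML (A : Type) : pred (form A) :=
  [pred phi | mu_free phi].
Definition logic_mu (A : Type) : pred (form A) :=
  [pred phi | well_formed phi && all_free phi].
Definition logic_RMLmu (A : Type) : pred (form A) :=
  [pred phi | well_formed phi].

Definition polynomially_bounded (f : nat -> nat) : Prop :=
  exists c d : nat, forall n, f n <= c * n ^ d + c.

(* f = Ω(n); the inequality forces [c > 0].                                   *)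
Definition Omega_linear (f : nat -> nat) : Prop :=
  exists c n0 : nat, forall n, n0 <= n -> n <= c * f n.

(* A natural-number exponent loses nothing: the floor of a real-valued Ω(n)   *)
(* function is again Ω(n).  As usual for Ω, the bound is for large n.         *)
Definition doubly_exponentially_more_succinct (A : Type)
    (L1 L2 : pred (form A)) : Prop :=
  exists phi : nat -> form A,
    [/\ forall n, L1 (phi n),
        polynomially_bounded (fun n => fsize (phi n))
      & exists2 f : nat -> nat, Omega_linear f &
          exists n0 : nat, forall n, n0 <= n ->
            forall psi : form A, L2 psi -> equivalent psi (phi n) ->
              2 ^ (2 ^ f n) <= fsize psi].

(* Main.v *)
Require Import Defs.
From mathcomp Require Import all_boot.
From mathcomp Require Import boolp zify.

(* A single family of RML formulas serves both parts, since K is contained in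
   the mu-calculus and RML in the refinement mu-calculus.  The root of a model
   has two successors, each carrying a set of words of length 2^n; a word is
   stored at the leaves of a complete binary tree of depth n.  The formula says
   that the two sets have a common word: for some refinement keeping a word on
   each side, with all its addresses, every further refinement whose leaves all
   have the same address has leaves of a single value.  A mu-calculus formula
   sees a successor of a root only through the truth values there of its
   outermost boxed subformulas.  These have to separate all 2^(2^(2^n)) sets of
   words, so there are at least 2^(2^n) of them. *)

Set Implicit Arguments.
Unset Strict Implicit.
Unset Printing Implicit Defensive.

Lemma mu_free_well_formed (A : Type) (phi : form A) :
  mu_free phi -> well_formed phi.
Proof.
by elim: phi => //= phi IHphi psi IHpsi /andP[/IHphi -> /IHpsi ->].
Qed.

(** * Lower bounds for the mu-calculus *)

(** No transition enters [X], so evaluation started outside [X] never meets it. *)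
Lemma sat_off (A S : Type) (R : A -> S -> S -> Prop) (X : S -> Prop)
    (phi : form A) :
  (forall a t u, R a t u -> ~ X u) -> all_free phi ->
  forall V W : nat -> S -> Prop,
  (forall p t, ~ X t -> V p t <-> W p t) ->
  forall t, ~ X t -> @sat A (Model R V) phi t <-> @sat A (Model R W) phi t.
Proof.
move=> Xnopred.
elim: phi => [p|phi IH|phi IHphi psi IHpsi|a phi IH|a phi IH|x phi IH] //=.
- by move=> _ V W VW t Xt; apply: VW.
- by move=> af V W VW t Xt; have := IH af V W VW t Xt; tauto.
- move=> /andP[af af'] V W VW t Xt.
  by have := IHphi af V W VW t Xt; have := IHpsi af' V W VW t Xt; tauto.
- move=> af V W VW t Xt; split=> H u Rtu.
    by apply/(IH af V W VW u (Xnopred _ _ _ Rtu))/H.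
  by apply/(IH af V W VW u (Xnopred _ _ _ Rtu))/H.
- move=> af.
  have half (V W : nat -> S -> Prop) : (forall p t, ~ X t -> V p t <-> W p t) ->
      forall t, ~ X t -> @sat A (Model R V) (Mu x phi) t ->
      @sat A (Model R W) (Mu x phi) t.
    move=> VW t Xt Vt T preT.
    (* Adding [X] to [T] confines the test to states outside [X], where the induction hypothesis
       applies. *)
    have [] // := Vt (fun u => X u \/ T u) => u phiu.
    have [Xu|Xu] := EM (X u); [by left | right; apply: preT; move: phiu].
    apply: (iffLR (IH af _ _ _ u Xu)) => p r Xr.
    by case: (p == x); [tauto | exact: VW].
  move=> V W VW t Xt; split; apply: half => // p u Xu.
  by split=> ?; apply/VW.
Qed.

(** Carrying the polarity [b], which exchanges [V] and [W], lets the induction pass negations. *)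
Lemma sat_mono (A S : Type) (R : A -> S -> S -> Prop) (x : nat)
    (phi : form A) : all_free phi ->
  forall (b : bool) (V W : nat -> S -> Prop), polarity b x phi ->
  (forall p, p != x -> V p = W p) -> (forall t, V x t -> W x t) ->
  forall t, @sat A (Model R (if b then V else W)) phi t ->
            @sat A (Model R (if b then W else V)) phi t.
Proof.
elim: phi => [p|phi IH|phi IHphi psi IHpsi|a phi IH|a phi IH|y phi IH] //=.
- move=> _ b V W; case: eqP => [-> /= -> _|/eqP px _ VW _ t]; first exact.
  by case: b; rewrite VW.
- move=> af b V W pol VW VWx t nphi phit; apply: nphi.
  by have := IH af (~~ b) V W pol VW VWx t; case: b {pol} phit => /= ? ; exact.
- move=> /andP[af af'] b V W /andP[pol pol'] VW VWx t [phit psit].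
  by split; [exact: IHphi phit | exact: IHpsi psit].
- by move=> af b V W pol VW VWx t H u Rtu; apply: IH => //; apply: H.
- move=> af b V W pol VW VWx t H T preT; apply: H => u phiu; apply: preT.
  pose V' p := if p == y then T else V p.
  pose W' p := if p == y then T else W p.
  have [yx|yx] := eqVneq y x.
    (* The binder overwrites the only variable at which [V] and [W] may differ. *)
    have E : (fun p => if p == y then T else (if b then V else W) p) =
        (fun p => if p == y then T else (if b then W else V) p).
      apply/funext => p; case: eqP => // /eqP; rewrite yx.
      by case: b {phiu pol} => /VW.
    by move: phiu; rewrite /update /= E.
  move: pol; rewrite (negPf yx) /= => pol.
  have := IH af b V' W' pol; rewrite /V' /W'.
  case: b phiu {pol} => phiu; apply=> //.
  + by move=> p px; case: eqP => // _; exact: VW.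
  + by move=> r; rewrite eq_sym (negPf yx); exact: VWx.
  + by move=> p px; case: eqP => // _; exact: VW.
  + by move=> r; rewrite eq_sym (negPf yx); exact: VWx.
Qed.

(* The truth of [phi] at a state without predecessors depends, besides the
   atoms, only on the truth of these predicates at its successors. *)
Fixpoint boxed (A : Type) (M : model A) (phi : form A) : seq (M -> Prop) :=
  match phi with
  | Var _ => [::]
  | Neg phi => boxed M phi
  | And phi psi => boxed M phi ++ boxed M psi
  | Box _ phi => [:: @sat A M phi]
  | All _ _ => [::]
  | Mu x phi => boxed (update x (@sat A M (Mu x phi))) phi
  end.

Lemma size_boxed (A : Type) (M : model A) (phi : form A) :
  size (boxed M phi) <= fsize phi.
Proof.
elim: phi M => [p|phi IH|phi IHphi psi IHpsi|a phi IH|a phi IH|x phi IH] M //=.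
- exact: leqW.
- by rewrite size_cat leqW // leq_add.
- exact: leqW (IH (update _ _)).
Qed.

(** Half of Knaster-Tarski: the fixed point lies below each prefixed [T], so by monotonicity its
    image does too. *)
Lemma sat_Mu_prefix (A S : Type) (R : A -> S -> S -> Prop) (x : nat)
    (phi : form A) (V : nat -> S -> Prop) (M := Model R V) :
  all_free phi -> polarity true x phi ->
  forall t, @sat A (update x (@sat A M (Mu x phi))) phi t ->
    @sat A M (Mu x phi) t.
Proof.
move=> af pol t phit T preT; apply: (preT); move: phit.
apply: (sat_mono (b := true)
  (V := fun p => if p == x then @sat A M (Mu x phi) else V p)
  (W := fun p => if p == x then T else V p) af pol) => [p /negPf -> //|u].
by rewrite eqxx; apply.
Qed.

(* If one unfolding does not put [s] into the fixed point, then removing [s]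
   from it leaves a prefixed point, because no other state sees [s]. *)
Lemma sat_Mu_root (A S : Type) (R : A -> S -> S -> Prop) (x : nat)
    (phi : form A) (V : nat -> S -> Prop) (M := Model R V) (s : S) :
  all_free phi -> polarity true x phi -> (forall a t, ~ R a t s) ->
  @sat A M (Mu x phi) s <->
  @sat A (@update A M x (fun t => t <> s /\ @sat A M (Mu x phi) t)) phi s.
Proof.
move=> af pol nopred; set W := fun t => _.
split=> [fixs|phis].
  apply: contrapT => nphis.
  suff [] : W s by [].
  apply: fixs => t phit.
  have ts : t <> s by move=> ts; apply: nphis; rewrite -ts.
  split=> //; apply: sat_Mu_prefix => //; move: phit.
  apply: (iffLR (sat_off (X := fun u => u = s) _ af _ ts)).
    by move=> a r u Rru us; rewrite us in Rru; exact: nopred Rru.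
  by move=> p r rs; case: (p == x) => //; rewrite /W; tauto.
apply: sat_Mu_prefix => //; move: phis.
apply: (sat_mono (b := true) (V := fun p => if p == x then W else V p)
  (W := fun p => if p == x then @sat A M (Mu x phi) else V p) af pol)
  => [p /negPf -> //|u].
by rewrite eqxx => -[].
Qed.

(** Unfolding a fixed point at a root deletes that root from the value of the variable, so the two
    roots come to be evaluated under different valuations [V1] and [V2]. These differ from [V], for
    which [boxed] is computed, only on [X]; successors lie outside [X] and do not notice. The
    default [fun=> True] makes indices past the end agree. *)
Lemma sat_root (A S : Type) (R : A -> S -> S -> Prop) (X : S -> Prop)
    (s1 s2 : S) (phi : form A) :
  (forall a t u, R a t u -> ~ X u) -> X s1 -> X s2 ->
  well_formed phi -> all_free phi ->
  forall V V1 V2 : nat -> S -> Prop,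
  (forall p t, ~ X t -> V p t <-> V1 p t) ->
  (forall p t, ~ X t -> V p t <-> V2 p t) ->
  (forall p, V1 p s1 <-> V2 p s2) ->
  let same u1 u2 := forall i,
    nth (fun=> True) (boxed (Model R V) phi) i u1 <->
    nth (fun=> True) (boxed (Model R V) phi) i u2 in
  (forall a u1, R a s1 u1 -> exists2 u2, R a s2 u2 & same u1 u2) ->
  (forall a u2, R a s2 u2 -> exists2 u1, R a s1 u1 & same u1 u2) ->
  @sat A (Model R V1) phi s1 <-> @sat A (Model R V2) phi s2.
Proof.
move=> Xnopred X1 X2.
elim: phi => [p|phi IH|phi IHphi psi IHpsi|b phi IH|b phi IH|x phi IH] //=.
- move=> wf af V V1 V2 VV1 VV2 V12 forth back.
  by have := IH wf af _ _ _ VV1 VV2 V12 forth back; tauto.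
- move=> /andP[wf wf'] /andP[af af'] V V1 V2 VV1 VV2 V12 forth back.
  set bphi := boxed _ phi in forth back; set bpsi := boxed _ psi in forth back.
  have catl (u1 u2 : S) : (forall i, nth (fun=> True) (bphi ++ bpsi) i u1 <->
      nth (fun=> True) (bphi ++ bpsi) i u2) ->
      forall i, nth (fun=> True) bphi i u1 <-> nth (fun=> True) bphi i u2.
    move=> H i; have [lt|ge] := ltnP i (size bphi); last by rewrite nth_default.
    by have := H i; rewrite nth_cat lt.
  have catr (u1 u2 : S) : (forall i, nth (fun=> True) (bphi ++ bpsi) i u1 <->
      nth (fun=> True) (bphi ++ bpsi) i u2) ->
      forall i, nth (fun=> True) bpsi i u1 <-> nth (fun=> True) bpsi i u2.
    move=> H i; have := H (size bphi + i).
    by rewrite nth_cat ltnNge leq_addr addKn.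
  have -> : @sat A (Model R V1) phi s1 <-> @sat A (Model R V2) phi s2.
    apply: (IHphi wf af _ _ _ VV1 VV2 V12) => a u Ru.
      by have [u2 ? /catl] := forth _ _ Ru; exists u2.
    by have [u1 ? /catl] := back _ _ Ru; exists u1.
  have -> // : @sat A (Model R V1) psi s1 <-> @sat A (Model R V2) psi s2.
  apply: (IHpsi wf' af' _ _ _ VV1 VV2 V12) => a u Ru.
    by have [u2 ? /catr] := forth _ _ Ru; exists u2.
  by have [u1 ? /catr] := back _ _ Ru; exists u1.
- move=> wf af V V1 V2 VV1 VV2 V12 forth back.
  split=> H u Ru.
    have [u1 Ru1 /(_ 0) /= same] := back _ _ Ru.
    apply/(sat_off Xnopred af VV2 (Xnopred _ _ _ Ru))/same.
    exact/(sat_off Xnopred af VV1 (Xnopred _ _ _ Ru1))/H.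
  have [u2 Ru2 /(_ 0) /= same] := forth _ _ Ru.
  apply/(sat_off Xnopred af VV1 (Xnopred _ _ _ Ru))/same.
  exact/(sat_off Xnopred af VV2 (Xnopred _ _ _ Ru2))/H.
- move=> /andP[pol wf] af V V1 V2 VV1 VV2 V12 forth back.
  have nopred s : X s -> forall a t, ~ R a t s by move=> Xs a t /Xnopred.
  have agree (W : nat -> S -> Prop) s : X s ->
      (forall p t, ~ X t -> V p t <-> W p t) -> forall p t, ~ X t ->
      (if p == x then @sat A (Model R V) (Mu x phi) else V p) t <->
      (if p == x then fun t => t <> s /\ @sat A (Model R W) (Mu x phi) t
       else W p) t.
    move=> Xs VW p t Xt; case: (p == x); last exact: VW.
    have := @sat_off A S R X (Mu x phi) Xnopred af V W VW t Xt.
    by have ts : t <> s by [move=> ts; rewrite ts in Xt]; tauto.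
  apply: (iff_trans (sat_Mu_root V1 af pol (nopred _ X1))).
  apply: iff_trans (iff_sym (sat_Mu_root V2 af pol (nopred _ X2))).
  apply: (IH wf af _ _ _ (agree _ _ X1 VV1) (agree _ _ X2 VV2)) => //= p.
  (* The variable is false at both roots, each being deleted in its own unfolding. *)
  by case: (p == x) => //; tauto.
Qed.

(** * Formulas *)

Definition Top (A : Type) : form A := Neg (And (Var 0) (Neg (Var 0))).
Definition Or (A : Type) (phi psi : form A) := Neg (And (Neg phi) (Neg psi)).
Definition Imp (A : Type) (phi psi : form A) := Neg (And phi (Neg psi)).
Definition Dia (A : Type) (a : A) (phi : form A) := Neg (Box a (Neg phi)).
Definition Ex (A : Type) (a : A) (phi : form A) := Neg (All a (Neg phi)).
Definition Boxn (A : Type) (a : A) (n : nat) (phi : form A) :=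
  iter n (Box a) phi.
Fixpoint Conj (A : Type) (f : nat -> form A) (n : nat) : form A :=
  if n is n'.+1 then And (f n') (Conj f n') else Top A.

Fixpoint reach (A : Type) (a : A) (M : model A) (n : nat) (s t : M) : Prop :=
  if n is n'.+1 then exists2 u, acc a s u & reach a n' u t else s = t.

Lemma sat_Top (A : Type) (M : model A) (s : M) : sat (Top A) s.
Proof. by rewrite /Top /=; tauto. Qed.

Lemma sat_And (A : Type) (M : model A) (phi psi : form A) (s : M) :
  sat (And phi psi) s <-> sat phi s /\ sat psi s.
Proof. by []. Qed.

Lemma sat_Or (A : Type) (M : model A) (phi psi : form A) (s : M) :
  sat (Or phi psi) s <-> sat phi s \/ sat psi s.
Proof.
by have := EM (sat phi s); have := EM (sat psi s); rewrite /=; tauto.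
Qed.

Lemma sat_Imp (A : Type) (M : model A) (phi psi : form A) (s : M) :
  sat (Imp phi psi) s <-> (sat phi s -> sat psi s).
Proof. by have := EM (sat psi s); rewrite /=; tauto. Qed.

Lemma sat_Dia (A : Type) (M : model A) (a : A) (phi : form A) (s : M) :
  sat (Dia a phi) s <-> exists2 t, acc a s t & sat phi t.
Proof.
split=> [H|[t st phit] H]; last exact: H phit.
by apply: contrapT => nex; apply: H => t st phit; apply: nex; exists t.
Qed.

Lemma sat_All (A : Type) (M : model A) (a : A) (phi : form A) (s : M) :
  sat (All a phi) s <->
  forall (M' : model A) (s' : M'), refines a s s' -> sat phi s'.
Proof. by []. Qed.

Lemma sat_Ex (A : Type) (M : model A) (a : A) (phi : form A) (s : M) :
  sat (Ex a phi) s <->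
  exists (M' : model A) (s' : M'), refines a s s' /\ sat phi s'.
Proof.
split=> [H|[M' [s' [ref phis']]] H]; last exact: H phis'.
apply: contrapT => nex; apply: H => M' s' ref phis'.
by apply: nex; exists M', s'.
Qed.

Lemma sat_Boxn (A : Type) (M : model A) (a : A) (n : nat) (phi : form A)
    (s : M) :
  sat (Boxn a n phi) s <-> forall t, reach a n s t -> sat phi t.
Proof.
elim: n s => [|n IH] s /=; first by split=> [H t <-|H]; [|exact: H].
split=> [H t [u su ut]|H u su]; first by move/IH: (H u su); apply.
by apply/IH => t ut; apply: H; exists u.
Qed.

Lemma sat_Conj (A : Type) (M : model A) (f : nat -> form A) (n : nat) (s : M) :
  sat (Conj f n) s <-> forall i, i < n -> sat (f i) s.
Proof.
elim: n => [|n IH]; first by split=> // _; exact: sat_Top.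
split=> [[fn /IH H] i|H].
  by rewrite ltnS leq_eqVlt => /orP[/eqP->|/H].
by split; [exact: H | apply/IH => i lt; apply: H; exact: ltnW].
Qed.

Lemma fsize_Boxn (A : Type) (a : A) (n : nat) (phi : form A) :
  fsize (Boxn a n phi) = n + fsize phi.
Proof. by elim: n => //= n ->. Qed.

Lemma fsize_Conj (A : Type) (f : nat -> form A) (n m : nat) :
  (forall i, i < n -> fsize (f i) <= m) -> fsize (Conj f n) <= n * m.+1 + 5.
Proof.
elim: n => [//|n IH H /=].
have := IH (fun i lt => H i (ltnW lt)); have := H n (ltnSn n); lia.
Qed.

Lemma mu_free_Boxn (A : Type) (a : A) (n : nat) (phi : form A) :
  mu_free (Boxn a n phi) = mu_free phi.
Proof. by elim: n. Qed.

Lemma mu_free_Conj (A : Type) (f : nat -> form A) (n : nat) :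
  (forall i, mu_free (f i)) -> mu_free (Conj f n).
Proof. by move=> H; elim: n => //= n ->; rewrite H. Qed.

(** Two steps lead from the root of the model to the roots of the trees, hence [i.+2]: both
    directions must remain at each depth below [n]. *)
Definition full (A : Type) (a : A) (n : nat) : form A :=
  Conj (fun i => Boxn a i.+2 (And (Dia a (Var 0)) (Dia a (Neg (Var 0))))) n.
(** Bit [i] of an address is read one level below depth [i] of the tree, where [Var 0] records the
    direction just taken. *)
Definition same_address (A : Type) (a : A) (n : nat) : form A :=
  Conj (fun i => Or (Boxn a i.+3 (Var 0)) (Boxn a i.+3 (Neg (Var 0)))) n.
Definition same_value (A : Type) (a : A) (n : nat) : form A :=
  Or (Boxn a n.+2 (Var 1)) (Boxn a n.+2 (Neg (Var 1))).
Definition common_word (A : Type) (a : A) (n : nat) : form A :=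
  Ex a (And (And (Dia a (And (Var 0) (Dia a (Top A))))
                 (Dia a (And (Neg (Var 0)) (Dia a (Top A)))))
            (And (full a n)
                 (All a (Imp (same_address a n) (same_value a n))))).

Lemma mu_free_common_word (A : Type) (a : A) (n : nat) :
  mu_free (common_word a n).
Proof.
rewrite /= !mu_free_Boxn /= !andbT.
by apply/andP; split; apply: mu_free_Conj => i /=; rewrite !mu_free_Boxn.
Qed.

Lemma fsize_common_word (A : Type) (a : A) (n : nat) :
  fsize (common_word a n) <= 100 * n ^ 2 + 100.
Proof.
have fullP : fsize (full a n) <= n * (n + 20).+1 + 5.
  by apply: fsize_Conj => i lt; rewrite fsize_Boxn /=; lia.
have sameP : fsize (same_address a n) <= n * (2 * n + 20).+1 + 5.
  by apply: fsize_Conj => i lt; rewrite /= !fsize_Boxn /=; lia.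
by move: fullP sameP => /=; rewrite !fsize_Boxn /= !expnS expn0; nia.
Qed.

(** * Families of words *)

Definition word := seq bool -> bool.

(* A node [Nd c w] is the root of the infinite binary tree carrying [w u] at
   address [u]; [c] is the direction taken to enter it. *)
Inductive node : Type :=
| Rt of (bool -> word -> Prop)
| Ob of bool & (word -> Prop)
| Nd of bool & word.

(** The root of a tree is entered in no direction; [false] is an arbitrary choice there. *)
Definition step (t u : node) : Prop :=
  match t, u with
  | Rt H, Ob b F => F = H b
  | Ob _ F, Nd c w => F w /\ c = false
  | Nd _ w, Nd c w' => w' = fun v => w (c :: v)
  | _, _ => False
  end.

Definition label (p : nat) (t : node) : Prop :=
  match t with
  | Rt _ => False
  | Ob b _ => p = 0 /\ b
  | Nd c w => if p == 0 then c else w [::]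
  end.

Definition families (A : Type) (a : A) : model A :=
  Model (fun b t u => b = a /\ step t u) label.

Definition meet (n : nat) (H : bool -> word -> Prop) : Prop :=
  exists w v, [/\ H true w, H false v & forall u, size u = n -> w u = v u].

(** * Prescribing addresses by pruning *)

Fixpoint follows (A : Type) (a : A) (M : model A) (s : M) (u : seq bool)
    (t : M) : Prop :=
  if u is b :: u' then exists r, [/\ acc a s r, valuation 0 r <-> b
    & follows a r u' t] else s = t.

(* Unravelling of [M] in which the directions of the [a]-steps are prescribed
   where the list has an entry [Some b]. *)
Definition prune (A : Type) (a : A) (M : model A) : model A :=
  @Model A (seq (option bool) * M)%type
    (fun b x y => [/\ acc b x.2 y.2, y.1 = behead x.1 & b = a ->
       forall c, head None x.1 = Some c -> valuation 0 y.2 <-> c])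
    (fun p x => valuation p x.2).

(** Pruning removes only [a]-steps, which refinement for [a] allows; the steps of other agents all
    survive. *)
Lemma refines_prune (A : Type) (a : A) (M : model A) (s : M) ds :
  @refines A a M (prune a M) s (ds, s).
Proof.
exists (fun t x => t = x.2); split=> // t [es r] /= -> {t}.
- by [].
- by move=> b [es' r'] [/= rr' _ _]; exists r'.
- by move=> b r' ba rr'; exists (behead es, r').
Qed.

(** Entry [k] of the list governs step [k.+1], since each step consumes one entry. *)
Lemma reach_prune (A : Type) (a : A) (M : model A) k ds (s t : M) es c :
  reach a k.+1 ((ds, s) : prune a M) ((es, t) : prune a M) ->
  nth None ds k = Some c -> valuation 0 t <-> c.
Proof.
elim: k ds s => [|k IH] ds s [[ds' r] [/= sr -> dir]] /=.
  by case=> _ <- dsc; apply: dir; rewrite // -nth0.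
by move=> rt dsc; apply: (IH (behead ds) r) => //; rewrite nth_behead.
Qed.

Lemma follows_prune (A : Type) (a : A) (M : model A) u (s t : M) :
  follows a s u t ->
  reach a (size u) ((map Some u, s) : prune a M) (([::], t) : prune a M).
Proof.
elim: u s => [|b u IH] s /= => [-> //|[r [sr rb rt]]].
by exists (map Some u, r); [split=> //= _ c [<-] | exact: IH].
Qed.

Lemma acc_prune_any (A : Type) (a : A) (M : model A) (s t : M) ds :
  acc a s t -> acc a ((None :: ds, s) : prune a M) ((ds, t) : prune a M).
Proof. by []. Qed.

(** * Reading words along a simulation *)

Definition simulates (A : Type) (M M' : model A) (F : M -> M' -> Prop) :=
  (forall t t', F t t' -> forall p, valuation p t <-> valuation p t') /\
  (forall t t', F t t' -> forall (b : A) (u' : M'), acc b t' u' ->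
     exists2 u : M, acc b t u & F u u').

Lemma bool_iffP (b c : bool) : b <-> c -> b = c.
Proof. by move=> bc; apply/idP/idP => /bc. Qed.

(** Fullness supplies a successor in the direction of each bit of [u]. It copies a child in the
    tree, and equal labels force this to be the child in that direction. *)
Lemma follows_full (A : Type) (a : A) (M : model A)
    (F : families a -> M -> Prop) (u : seq bool) c w (x : M) :
  simulates F -> F (Nd c w) x ->
  (forall i, i < size u -> forall t, reach a i x t -> forall b : bool,
     exists2 r, acc a t r & valuation 0 r <-> b) ->
  exists2 y, follows a x u y & (valuation 1 y <-> w u).
Proof.
move=> [Fval Fback]; elim: u c w x => [|b u IH] c w x Fx fullx /=.
  by exists x => //; rewrite -(Fval _ _ Fx).
have [r xr rb] := fullx 0 isT x erefl b.
have [t [_ st] Fr] := Fback _ _ Fx _ _ xr.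
case: t st Fr => [//|//|c' w'] /= -> Fr.
have c'b : c' = b by apply: bool_iffP; exact: iff_trans (Fval _ _ Fr 0) rb.
rewrite c'b in Fr.
have [|y ry yu] := IH _ _ r Fr; last by exists y => //; exists r.
by move=> i lt t rt b'; apply: (fullx i.+1) => //; exists r.
Qed.

(** Here the path is given, and the labels along it tell which child in the tree each state
    copies. *)
Lemma reach_address (A : Type) (a : A) (M : model A)
    (F : families a -> M -> Prop) (u : seq bool) c w (x y : M) :
  simulates F -> F (Nd c w) x ->
  (forall i, i < size u -> forall t, reach a i.+1 x t ->
     (valuation 0 t <-> nth false u i)) ->
  reach a (size u) x y -> (valuation 1 y <-> w u).
Proof.
move=> [Fval Fback]; elim: u c w x => [|b u IH] c w x Fx addr /=.
  by move=> <-; rewrite -(Fval _ _ Fx).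
case=> r xr ry.
have [t [_ st] Fr] := Fback _ _ Fx _ _ xr.
case: t st Fr => [//|//|c' w'] /= -> Fr.
have c'b : c' = b.
  apply: bool_iffP; apply: iff_trans (Fval _ _ Fr 0) _.
  by apply: (addr 0) => //; exists r.
rewrite c'b in Fr.
apply: (IH _ _ r Fr) => // i lt t rt.
by apply: (addr i.+1) => //; exists r.
Qed.

(** * Meaning of the formulas *)

Lemma sat_full (A : Type) (M : model A) (a : A) (n : nat) (s : M) :
  sat (full a n) s <->
  forall i, i < n -> forall t, reach a i.+2 s t ->
    forall b : bool, exists2 r, acc a t r & valuation 0 r <-> b.
Proof.
rewrite /full sat_Conj; split=> H i lt.
  move=> t it; have /sat_Boxn/(_ t it)/sat_And[] := H i lt.
  move=> /sat_Dia[r1 tr1 p1] /sat_Dia[r0 tr0 p0] [].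
    by exists r1.
  by exists r0.
apply/sat_Boxn => t /(H i lt) {}H; split; apply/sat_Dia.
  by have [r tr rb] := H true; exists r => //; apply/rb.
by have [r tr rb] := H false; exists r => // /rb.
Qed.

Lemma sat_same_address (A : Type) (M : model A) (a : A) (n : nat) (s : M) :
  sat (same_address a n) s <->
  exists2 u : seq bool, size u = n & forall i, i < n ->
    forall t, reach a i.+3 s t -> (valuation 0 t <-> nth false u i).
Proof.
rewrite /same_address sat_Conj; split=> [H|[u szu H] i lt].
  (* Bit [i] is set when all states at depth [i.+3] satisfy [Var 0], in particular when there are
     none. *)
  exists (mkseq (fun i => `[< sat (Boxn a i.+3 (Var 0)) s >]) n).
    by rewrite size_mkseq.
  move=> i lt t st; rewrite nth_mkseq //.
  case: asboolP => [/sat_Boxn/(_ t st) //|nbox].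
  have /sat_Or[//|/sat_Boxn/(_ t st) nt] := H i lt.
  by split.
apply/sat_Or; case E: (nth false u i); [left|right]; apply/sat_Boxn => t st.
  by apply/(H i lt t st).
by move=> /(H i lt t st); rewrite E.
Qed.

Lemma sat_same_value (A : Type) (M : model A) (a : A) (n : nat) (s : M) :
  sat (same_value a n) s <->
  exists b : bool, forall t, reach a n.+2 s t -> (valuation 1 t <-> b).
Proof.
rewrite /same_value sat_Or !sat_Boxn; split=> [[H|H]|[[] H]].
- by exists true => t /H.
- by exists false => t /H.
- by left=> t st; apply/(H t st).
- by right=> t st /(H t st).
Qed.

Lemma reach_node (A : Type) (a : A) n c w (t : families a) :
  reach a n (Nd c w : families a) t -> exists c' w', t = Nd c' w'.
Proof.
elim: n c w => [|n IH] c w /= => [<-|[r [_ st]]]; first by exists c, w.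
by case: r st => [//|//|c' w'] _ /IH.
Qed.

Lemma refines_families (A : Type) (a : A) (H H' : bool -> word -> Prop) :
  (forall b w, H' b w -> H b w) ->
  @refines A a (families a) (families a) (Rt H) (Rt H').
Proof.
move=> sub.
exists (fun t t' => match t, t' with
  | Rt K, Rt K' => forall b w, K' b w -> K b w
  | Ob b F, Ob b' F' => b = b' /\ forall w, F' w -> F w
  | Nd c w, Nd c' w' => c = c' /\ w = w'
  | _, _ => False end); split=> //.
- by move=> [K|b F|c w] [K'|b' F'|c' w'] //= [-> // ->].
- move=> [K|b F|c w] [K'|b' F'|c' w'] //= rel
    a' [K''|b'' F''|c'' w''] //= [-> //].
  + by move=> ->; exists (Ob b'' (K b'')) => //=; split=> //; apply: rel.
  + move=> [Fw ->]; exists (Nd false w'') => //=; split=> //; split=> //.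
    by case: rel => _; apply.
  + move=> ->; exists (Nd c'' (fun v => w (c'' :: v))) => //=.
    by case: rel => _ ->.
- by move=> t t' _ b u ba [].
Qed.

Lemma sat_common_word (A : Type) (a : A) (n : nat) H :
  @sat A (families a) (common_word a n) (Rt H) <-> meet n H.
Proof.
rewrite /common_word sat_Ex; split.
  case=> M [s [[F [Fs Fval Fback _]]]].
  move=> /sat_And[/sat_And[/sat_Dia[o1 so1] /sat_And[o1p /sat_Dia[x1 ox1 _]]]].
  move=> /sat_Dia[o0 so0] /sat_And[o0p /sat_Dia[x0 ox0 _]].
  move=> /sat_And[/sat_full fulls /sat_All alls].
  have [t1 [_ st1] Fo1] := Fback _ _ Fs _ _ so1.
  case: t1 st1 Fo1 => [//|b1 F1|//] /= F1E Fo1.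
  have [t0 [_ st0] Fo0] := Fback _ _ Fs _ _ so0.
  case: t0 st0 Fo0 => [//|b0 F0|//] /= F0E Fo0.
  have b1E : b1 = true by have [_ /(_ o1p) []] := Fval _ _ Fo1 0.
  have b0E : b0 = false.
    by apply/negbTE/negP => b0t; apply: o0p; apply/(Fval _ _ Fo0 0).
  have [t1 [_ st1] Fx1] := Fback _ _ Fo1 _ _ ox1.
  case: t1 st1 Fx1 => [//|//|c1 w] /= [F1w _] Fx1.
  have [t0 [_ st0] Fx0] := Fback _ _ Fo0 _ _ ox0.
  case: t0 st0 Fx0 => [//|//|c0 v] /= [F0v _] Fx0.
  exists w, v; split; [by rewrite -b1E -F1E | by rewrite -b0E -F0E |].
  move=> u szu; have sim : simulates F by [].
  (* The two [None] leave the steps down to the trees free; below, every path must follow [u]. *)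
  pose ds : seq (option bool) := [:: None, None & map Some u].
  have /sat_Imp imp := alls _ _ (refines_prune a s ds).
  have /imp/sat_same_value[b Hb] : sat (same_address a n) ((ds, s) : prune a M).
    apply/sat_same_address; exists u => // i lt [es t] st.
    by apply: (reach_prune st); rewrite /= (nth_map false) ?szu.
  (* By fullness the tree has a leaf at [u], which survives the pruning and so carries the common
     value [b]. *)
  have leaf o x c z : acc a s o -> acc a o x -> F (Nd c z) x -> z u = b.
    move=> so ox Fx.
    have [|y xy yz] := follows_full (u := u) sim Fx.
      move=> i lt t xt; apply: (fulls i); first by rewrite -szu.
      by exists o => //; exists x.
    have /Hb /= : reach a n.+2 ((ds, s) : prune a M) (([::], y) : prune a M).
      exists (behead ds, o); first exact: acc_prune_any.
      exists (map Some u, x); first exact: acc_prune_any.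
      by rewrite -szu; exact: follows_prune.
    by rewrite yz => zb; apply/idP/idP => /zb.
  by rewrite (leaf _ _ _ _ so1 ox1 Fx1) (leaf _ _ _ _ so0 ox0 Fx0).
case=> w [v [Hw Hv wv]].
(* The refinement keeps just [w] on one side and [v] on the other. *)
pose wd b := if b then w else v; pose H' b := eq (wd b).
exists (families a), (Rt H'); split.
  by apply: refines_families => -[] ? <-.
apply/sat_And; split; apply/sat_And; split.
- apply/sat_Dia; exists (Ob true (H' true)) => //; apply/sat_And; split=> //.
  by apply/sat_Dia; exists (Nd false w) => //; exact: sat_Top.
- apply/sat_Dia; exists (Ob false (H' false)) => //; apply/sat_And.
  split; first by case.
  by apply/sat_Dia; exists (Nd false v) => //; exact: sat_Top.
- apply/sat_full => i _ t /= [o [_ so] [x [_ ox] xt]] b'.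
  case: o so ox => [//|b F|//] _; case: x xt => [//|//|c z] zt _.
  have [c' [w' ->]] := reach_node zt.
  by exists (Nd b' (fun u => w' (b' :: u))) => //; case: b'.
- apply/sat_All => M s [F [Fs Fval Fback _]]; apply/sat_Imp.
  move=> /sat_same_address[u szu addr].
  (* Every leaf left copies the leaf at [u] of [w] or of [v], and these carry the same value. *)
  apply/sat_same_value; exists (w u) => y [o so [x ox xy]].
  have [t [_ st] Fo] := Fback _ _ Fs _ _ so.
  case: t st Fo => [//|b K|//] /= KE Fo.
  have [t [_ st] Fx] := Fback _ _ Fo _ _ ox.
  case: t st Fx => [//|//|c z] /= [Kz _] Fx.
  have <- : wd b u = w u by rewrite /wd; case: (b) => //; rewrite wv.
  rewrite KE in Kz; rewrite Kz; apply: (reach_address _ Fx) => //;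
    last by rewrite szu.
  rewrite szu => i lt t xt; apply: (addr i lt).
  by exists o => //; exists x.
Qed.

(** * Counting finite families of words *)

Definition restrict (n : nat) (w : word) : {ffun n.-tuple bool -> bool} :=
  [ffun u : n.-tuple bool => w u].

Definition extend (n : nat) (f : {ffun n.-tuple bool -> bool}) : word :=
  fun u => if insub u is Some v then f v else false.

Lemma extendK (n : nat) : cancel (@extend n) (@restrict n).
Proof. by move=> f; apply/ffunP => u; rewrite ffunE /extend valK. Qed.

Definition family (n : nat) (S : {set {ffun n.-tuple bool -> bool}}) :
    word -> Prop := fun w => restrict n w \in S.

Lemma meet_family (n : nat) (S T : {set {ffun n.-tuple bool -> bool}}) :
  meet n (fun b => family (if b then S else T)) <-> ~~ [disjoint S & T].
Proof.
split=> [[w [v [Sw Tv wv]]]|/pred0Pn[f /andP[Sf Tf]]].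
  apply/pred0Pn; exists (restrict n w); apply/andP; split=> //.
  suff -> : restrict n w = restrict n v by [].
  by apply/ffunP => u; rewrite !ffunE wv // size_tuple.
by exists (extend f), (extend f); split=> //; rewrite /family extendK.
Qed.

Lemma common_word_lower_bound (A : Type) (a : A) (n : nat) (psi : form A) :
  well_formed psi -> all_free psi -> equivalent psi (common_word a n) ->
  2 ^ (2 ^ n) <= fsize psi.
Proof.
move=> wf af eqv.
apply: leq_trans (size_boxed (families a) psi).
set bs := boxed _ _.
(* This is all that [psi] can observe, beyond atoms, at the [true] successor of a root. *)
pose type (S : {set {ffun n.-tuple bool -> bool}}) :=
  map_tuple (fun P => `[< P (Ob true (family S)) >]) (in_tuple bs).
have psiP (S T : {set {ffun n.-tuple bool -> bool}}) : @sat A (families a) psi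
    (Rt (fun b => family (if b then S else T))) <-> ~~ [disjoint S & T].
  apply: (iff_trans (eqv _ _)); apply: (iff_trans (sat_common_word a n _)).
  exact: meet_family.
have transfer (S T U : {set {ffun n.-tuple bool -> bool}}) :
    type S = type T -> ~~ [disjoint S & U] ->
    ~~ [disjoint T & U].
  move=> ST /(iffRL (psiP S U)) psiSU; apply: (iffLR (psiP T U)); move: psiSU.
  have same i : nth (fun=> True) bs i (Ob true (family S)) <->
      nth (fun=> True) bs i (Ob true (family T)).
    have [lt|ge] := ltnP i (size bs); last by rewrite nth_default.
    have := congr1 (fun t => nth true (val t) i) ST.
    by rewrite /= !(nth_map (fun=> True)) //; exact: asbool_eq_equiv.
  (* No step enters a root, so the roots can serve as the set [X]. *)
  pose root (t : node) := if t is Rt _ then True else False.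
  apply: (iffLR (sat_root (X := root) (V := label)
    _ _ _ wf af _ _ _ _ _)) => //=.
  - by move=> b t u [_ +] rootu; case: u rootu => // K _; case: t.
  (* Only the [true] side is exchanged; the [false] side answers for itself. *)
  - move=> b u [-> st]; case: u st => [//|[] F|//] /= ->.
      by exists (Ob true (family T)).
    by exists (Ob false (family U)).
  - move=> b u [-> st]; case: u st => [//|[] F|//] /= ->.
      by exists (Ob true (family S)).
    by exists (Ob false (family U)).
(* A set not inside [T] meets the complement of [T], which [T] does not; equal types exclude
   this. *)
have sub S T : type S = type T -> S \subset T.
  move=> ST; rewrite -(setCK T) -disjoints_subset; apply: contraT.
  by move=> /(transfer _ _ _ ST); rewrite disjoints_subset setCK subxx.
have type_inj : injective type.
  by move=> S T ST; apply/eqP; rewrite eqEsubset !sub.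
(* The [2 ^ (2 ^ (2 ^ n))] sets inject into Boolean tuples of length [size bs]; comparing exponents
   gives the bound. *)
have := leq_card _ type_inj.
by rewrite -cardsT -powersetT card_powerset cardsT card_ffun !card_tuple
  card_bool leq_exp2l // leq_exp2l.
Qed.

Theorem theorem10 (A : Type) (a0 : A) :
  doubly_exponentially_more_succinct (@logic_RML A) (@logic_K A) /\
  doubly_exponentially_more_succinct (@logic_RMLmu A) (@logic_mu A).
Proof.
have poly : polynomially_bounded (fun n => fsize (common_word a0 n)).
  by exists 100, 2; exact: fsize_common_word.
have lin : Omega_linear id by exists 1, 0 => n _; rewrite mul1n.
split; exists (common_word a0); split=> //.
- exact: mu_free_common_word.
- exists id => //; exists 0 => n _ psi /andP[mf af].
  exact/common_word_lower_bound/af/mu_free_well_formed.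
- by move=> n; exact/mu_free_well_formed/mu_free_common_word.
- exists id => //; exists 0 => n _ psi /andP[wf af].
  exact: common_word_lower_bound.
Qed.
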